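(* Let $P$ be a finite poset. If the cover graph of $P$ has pathwidth at most $2$, then $\dim(P)\leq 17$.
   Context: For a poset $P$, $x$ is covered by $y$ if $x<y$ and there is no $z$ with $x<z<y$. The cover graph of $P$ is the graph on the elements of $P$ in which $x$ and $y$ are adjacent iff one covers the other. The dimension $\dim(P)$ is the least $t$ such that there are linear extensions $L_1,\dots,L_t$ of $P$ with $x<_P y$ iff $x<_{L_i}y$ for all $i$. A path-decomposition of a graph $G=(V,E)$ is a sequence of subsets (bags) $V_1,\dots,V_n$ of $V$ whose union is $V$, such that every edge lies in some bag, and whenever $i<j<k$ we have $V_i\cap V_k\subseteq V_j$; its width is $\max_i|V_i|-1$, and the pathwidth of $G$ is the minimum width of a path-decomposition of $G$. *)

(* Defs.v *)
From mathcomp Require Import all_boot all_order.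
From mathcomp Require Import boolp zify.

Set Implicit Arguments.
Unset Strict Implicit.
Unset Printing Implicit Defensive.

Import Order.TTheory.

Local Open Scope order_scope.

Section Dimension.
Context {d : Order.disp_t} (P : finPOrderType d).

(* [L x y] is the strict order x <_L y. *)
Definition linear_extension (L : rel P) : Prop :=
  [/\ irreflexive L, transitive L,
      forall x y : P, x != y -> L x y || L y x
    & forall x y : P, x < y -> L x y].

Definition realizer (t : nat) (L : 'I_t -> rel P) : Prop :=
  (forall i, linear_extension (L i)) /\
  (forall x y : P, x < y <-> forall i, L i x y).

Definition has_realizer (t : nat) : Prop :=
  exists L : 'I_t -> rel P, realizer L.

(* Sorting by this key gives a linear extension in which the elements below y
   come first, and each part is sorted by down-set size, then by rank. *)
Let key (y z : P) : nat :=
  (~~ (z <= y)%O * #|P|.+1 ^ 2 + #|[set u : P | (u < z)%O]| * #|P|.+1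
   + enum_rank z)%N.

Let keyL (y : P) : rel P := fun z w => (key y z < key y w)%N.

Let down_le (z : P) : (#|[set u : P | (u < z)%O]| <= #|P|)%N.
Proof. exact: max_card. Qed.

Let rank_lt (z : P) : (enum_rank z < #|P|)%N.
Proof. exact: ltn_ord. Qed.

Let same_block (b : bool) (z w : P) : z < w ->
  (b * #|P|.+1 ^ 2 + #|[set u : P | (u < z)%O]| * #|P|.+1 + enum_rank z <
   b * #|P|.+1 ^ 2 + #|[set u : P | (u < w)%O]| * #|P|.+1 + enum_rank w)%N.
Proof.
move=> zw.
have lt_down : (#|[set u : P | (u < z)%O]| < #|[set u : P | (u < w)%O]|)%N.
  apply/proper_card/properP; split; last by exists z; rewrite !inE ?ltxx.
  by apply/subsetP => u; rewrite !inE => /lt_trans; apply.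
have lex (i j a c n : nat) :
    (a < c -> i < n -> a * n.+1 + i < c * n.+1 + j)%N.
  by nia.
by rewrite -!addnA ltn_add2l lex // rank_lt.
Qed.

Let key_inj y : injective (key y).
Proof.
move=> z w /(congr1 (modn^~ #|P|.+1)); rewrite /key.
rewrite expnS expn1 !mulnA -!mulnDl !modnMDl.
rewrite !modn_small ?ltnS 1?ltnW ?rank_lt //.
by move/val_inj/enum_rank_inj.
Qed.

Let keyL_below y z w : z <= y -> ~~ (w <= y) -> keyL y z w.
Proof.
rewrite /keyL /key => -> -> /=.
have lex (i j a c n : nat) :
    (a <= n -> i < n -> 0 * n.+1 ^ 2 + a * n.+1 + i <
                        1 * n.+1 ^ 2 + c * n.+1 + j)%N.
  by nia.
exact: lex.
Qed.

Let keyL_ext y : linear_extension (keyL y).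
Proof.
split=> [z|w z v|z w|z w zw].
- exact: ltnn.
- exact: ltn_trans.
- by rewrite /keyL -neq_ltn; apply: contra_neq => /key_inj.
- have [wy|wy] := boolP (w <= y); last first.
    have [zy|zy] := boolP (z <= y); first exact: keyL_below.
    by rewrite /keyL /key (negbTE wy) (negbTE zy); exact: same_block.
  by rewrite /keyL /key wy (le_trans (ltW zw) wy); exact: same_block.
Qed.

Lemma has_realizer_card : has_realizer #|P|.
Proof.
exists (fun i => keyL (enum_val i)); split=> [i|x y]; first exact: keyL_ext.
split=> [xy i|xLy]; first by case: (keyL_ext (enum_val i)) => _ _ _; apply.
have {}xLy : keyL y x y by have := xLy (enum_rank y); rewrite enum_rankK.
rewrite lt_neqAle; apply/andP; split.
  by apply: contraL xLy => /eqP->; rewrite /keyL ltnn.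
apply: contraLR xLy => xy.
rewrite /keyL -leqNgt ltnW //; exact: keyL_below.
Qed.

Fact poset_dim_subproof : exists t, `[< has_realizer t >].
Proof. by exists #|P|; apply/asboolP/has_realizer_card. Qed.

Definition poset_dim : nat := ex_minn poset_dim_subproof.

Definition covered_by (x y : P) : bool :=
  (x < y) && ~~ [exists z : P, (x < z) && (z < y)].

Definition cover_graph : rel P := fun x y => covered_by x y || covered_by y x.

End Dimension.

Arguments cover_graph {d} P.

Section Pathwidth.
Context {V : finType} (E : rel V).

Definition path_decomposition (bags : seq {set V}) : Prop :=
  [/\ forall v : V, exists2 B, B \in bags & v \in B,
      forall u v : V, E u v -> exists2 B, B \in bags & (u \in B) && (v \in B)
    & forall i j k : nat, (i < j < k)%N -> (k < size bags)%N ->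
        nth set0 bags i :&: nth set0 bags k \subset nth set0 bags j].

(* The predecessor truncates: the null graph gets width 0 rather than -1. *)
Definition width (bags : seq {set V}) : nat :=
  (\max_(B <- bags) #|B|).-1.

Definition has_width (w : nat) : Prop :=
  exists2 bags, path_decomposition bags & width bags = w.

Fact pathwidth_subproof : exists w, `[< has_width w >].
Proof.
exists (width [:: [set: V]]); apply/asboolP; exists [:: [set: V]] => //.
split=> [v|u v _|i j [|k] //].
- by exists setT; rewrite !inE.
- by exists setT; rewrite !inE.
- by rewrite ltn0 andbF.
Qed.

Definition pathwidth : nat := ex_minn pathwidth_subproof.

End Pathwidth.

(* Main.v *)
Require Import Defs.
From mathcomp Require Import all_boot all_order.
From mathcomp Require Import boolp zify.

(** Sweep through a path-decomposition of width 2 and order the elements by their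
    introduction. Just before each introduction at most two elements are still
    active; they form a separator, and the separators can be arranged as two
    tracks of which only one moves per step. Every comparability that crosses a
    separator passes through one of its elements. For an incomparable pair (x, y)
    with x introduced before y, the up-set of x and the down-set of y are disjoint
    on every separator in between. So either one of them misses some separator, or
    the up-set of x stays on one track and the down-set of y on the other one, and
    the tracks cannot be exchanged on the way because one of them is always kept.
    These four classes, and the four dual ones for pairs with y introduced first,
    contain no alternating cycle, whence dim P <= 8. *)

Set Implicit Arguments.
Unset Strict Implicit.
Unset Printing Implicit Defensive.

Import Order.TTheory.

Definition acyclic (T : finType) (r : rel T) : Prop :=
  forall p q, connect r p q -> ~~ r q p.

Lemma acyclic_rev (T : finType) (r : rel T) :
  acyclic r -> acyclic (fun x y => r y x).
Proof.
move=> ac p q pq; apply/negP => rpq.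
have qp : connect r q p by rewrite connect_rev.
by move: (ac _ _ qp); rewrite rpq.
Qed.

Lemma eq_acyclic (T : finType) (r r' : rel T) :
  r =2 r' -> acyclic r -> acyclic r'.
Proof. by move=> e ac p q; rewrite -(eq_connect e) -e; apply: ac. Qed.

Lemma acyclic_preim (T U : finType) (f : T -> U) (r : rel U) :
  acyclic r -> acyclic (relpre f r).
Proof.
move=> ac p q /connectP[s ps ->]; apply: ac; apply/connectP.
by exists (map f s); rewrite ?last_map ?path_map.
Qed.

(* In a shortest cycle every arc from [p] to [q] closes a chordless path from
   [q] to [p], so a predicate [G] as below would propagate from [q] to [p]. *)
Lemma acyclic_criterion (T : finType) (r : rel T) (m : T -> nat) :
  (forall p q, r p q -> (m q < m p)%N \/
     exists G : pred T, [/\ G q, ~~ G p &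
       forall u w, r u w -> ~~ r u q -> ~~ r p w -> G u -> G w]) ->
  acyclic r.
Proof.
move=> H.
suff nocyc n : forall q s, size s = n -> path r q s -> r (last q s) q -> False.
  by move=> p q /connectP[s ps ->]; apply/negP => /(nocyc _ _ _ erefl ps).
elim/ltn_ind: n => n IH q0 s0 sz0 ps0 r0.
pose c := q0 :: s0.
have cyc0 : cycle r c by rewrite /= rcons_path ps0.
have [p pc pmin] : exists2 p, p \in c & forall u, u \in c -> (m p <= m u)%N.
  have q0c : q0 \in c by rewrite mem_head.
  by case: (arg_minnP m q0c) => p pc pmin; exists p.
have [q [s [rpq ps lps sz qc]]] : exists q s,
    [/\ r p q, path r q s, last q s = p, size s = n & q \in c].
  have [i s ec] := rot_to pc.
  have: cycle r (p :: s) by rewrite -ec rot_cycle.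
  have: size (p :: s) = n.+1 by rewrite -ec size_rot /= sz0.
  have: {subset s <= c} by move=> u us; rewrite -(mem_rot i) ec inE us orbT.
  case: s {ec} => [|q s] sc /= [sz].
    by case/andP=> rpp _; exists p, [::].
  case/andP=> rpq ps; exists q, (rcons s p); split=> //.
  - by rewrite last_rcons.
  - by rewrite size_rcons.
  - by rewrite sc ?mem_head.
have [|[G [Gq Gp Gs]]] := H _ _ rpq; first by rewrite ltnNge pmin.
suff prefix s1 s2 : s = s1 ++ s2 -> G (last q s1).
  by move: (prefix s [::]); rewrite cats0 lps (negbTE Gp) => /(_ erefl).
elim/last_ind: s1 s2 => [|s1 w IHs] // s2; rewrite cat_rcons => es.
have [ps1 ruw ps2] : [/\ path r q s1, r (last q s1) w & path r w s2].
  by move: ps; rewrite es cat_path /= => /and3P[].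
have sz12 : n = (size s1 + (size s2).+1)%N by rewrite -sz es size_cat.
rewrite last_rcons; apply: (Gs (last q s1)) => //; last exact: IHs es.
- apply/negP => ru; apply: (IH (size s1) _ _ _ erefl ps1 ru); lia.
- apply/negP => rw; apply: (IH (size s2) _ w s2 erefl ps2); first lia.
  by move: lps; rewrite es last_cat /= => ->.
Qed.

Section LinearExtension.
Context {d : Order.disp_t} (P : finPOrderType d).
Local Open Scope order_scope.

Definition alternating (S : rel P) : rel (P * P) :=
  fun p q => [&& S p.1 p.2, S q.1 q.2 & p.1 <= q.2].

Lemma reversing_extension (S : rel P) : acyclic (alternating S) ->
  exists2 L : rel P, linear_extension L & forall x y, S x y -> L y x.
Proof.
set r := alternating S => ac.
pose Q x y := (x <= y) || [exists p : P * P, exists q : P * P,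
  [&& S p.1 p.2, S q.1 q.2, x <= p.2, connect r p q & q.1 <= y]].
have QP x y : Q x y -> x <= y \/ exists p q : P * P,
    [/\ S p.1 p.2, S q.1 q.2, x <= p.2, connect r p q & q.1 <= y].
  case/orP=> [|/existsP[p /existsP[q /and5P[]]]]; first by left.
  by move=> *; right; exists p, q.
have QI x y p q : S p.1 p.2 -> S q.1 q.2 -> x <= p.2 -> connect r p q ->
    q.1 <= y -> Q x y.
  move=> *; apply/orP; right; apply/existsP; exists p; apply/existsP; exists q.
  by apply/and5P.
have rI p q : S p.1 p.2 -> S q.1 q.2 -> p.1 <= q.2 -> r p q.
  by move=> *; apply/and3P.
have Qxx x : Q x x by rewrite /Q lexx.
have Qtrans : transitive Q.
  move=> y x z /QP[xy|[p [q [Sp Sq xp pq qy]]]] /QP[yz|[p' [q' [Sp' Sq' yp' pq' qz]]]].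
  - by rewrite /Q (le_trans xy yz).
  - exact: (QI _ _ p' q') (le_trans xy yp') _ _.
  - exact: (QI _ _ p q) (le_trans qy yz).
  - apply: (QI _ _ p q') => //; apply: connect_trans pq _.
    apply: connect_trans pq'; apply: connect1.
    exact: rI (le_trans qy yp').
have Qanti x y : Q x y -> Q y x -> x = y.
  have cyc p q : S p.1 p.2 -> S q.1 q.2 -> connect r p q -> q.1 <= p.2 -> False.
    by move=> Sp Sq pq qp; move: (ac _ _ pq); rewrite (rI q p).
  move=> /QP[xy|[p [q [Sp Sq xp pq qy]]]] /QP[yz|[p' [q' [Sp' Sq' yp' pq' qz]]]].
  - by apply/le_anti/andP.
  - by case: (cyc p' q') => //; apply: le_trans qz (le_trans xy yp').
  - by case: (cyc p q) => //; apply: le_trans qy (le_trans yz xp).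
  - case: (cyc p q') => //; last exact: le_trans qz xp.
    apply: connect_trans pq _; apply: connect_trans pq'; apply: connect1.
    exact: rI (le_trans qy yp').
pose k z := (#|[set u | Q u z]| * #|P| + enum_rank z)%N.
have rank_lt (z : P) : (enum_rank z < #|P|)%N by exact: ltn_ord.
have kQ z w : Q z w -> z != w -> (k z < k w)%N.
  move=> zw nzw.
  have lt : (#|[set u | Q u z]| < #|[set u | Q u w]|)%N.
    apply/proper_card/properP; split.
      by apply/subsetP => u; rewrite !inE => /Qtrans; apply.
    exists w; rewrite !inE ?Qxx //; apply: contraNN nzw => wz.
    by rewrite (Qanti _ _ zw wz).
  by rewrite /k; have := rank_lt z; have := rank_lt w; nia.
have kinj : injective k.
  move=> z w /(congr1 (modn^~ #|P|)); rewrite /k !modnMDl !modn_small ?rank_lt //.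
  by move/val_inj/enum_rank_inj.
exists (fun z w => (k z < k w)%N); last first.
  move=> x y Sxy; apply: kQ; first exact: (QI _ _ (x, y) (x, y)).
  apply/eqP => yx; have := ac (x, y) (x, y) (connect0 _ _).
  by rewrite rI //= yx.
split=> [z|w z v|z w nzw|z w zw].
- exact: ltnn.
- exact: ltn_trans.
- by rewrite -neq_ltn; apply: contra_neq nzw => /kinj.
- by apply: kQ; rewrite ?lt_eqF // /Q ltW.
Qed.

Lemma has_realizer_of_cover (I : finType) (i0 : I) (S : I -> rel P) :
  (forall i, acyclic (alternating (S i))) ->
  (forall x y : P, ~~ (x <= y) -> ~~ (y <= x) -> exists i, S i x y) ->
  has_realizer P #|I|.
Proof.
move=> ac cover.
have /choice[L HL] : forall i, exists L : rel P,
    linear_extension L /\ forall x y, S i x y -> L y x.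
  by move=> i; have [L ? ?] := reversing_extension (ac i); exists L.
exists (fun i => L (enum_val i)); split=> [i|x y]; first by case: (HL (enum_val i)).
split=> [xy i|Lxy]; first by case: (HL (enum_val i)) => -[_ _ _ ext] _; apply: ext.
have {}Lxy i : L i x y by have := Lxy (enum_rank i); rewrite enum_rankK.
have Lyx i : L i y x -> False.
  case: (HL i) => -[irr tr _ _] _ yx.
  by have := tr _ _ _ (Lxy i) yx; rewrite irr.
have nyx : ~~ (y <= x).
  apply/negP; rewrite le_eqVlt => /orP[/eqP e|yx].
    by apply: (Lyx i0); move: (Lxy i0); rewrite e.
  by apply: (Lyx i0); case: (HL i0) => -[_ _ _ ext] _; apply: ext.
apply: contraT => nxy.
have [||i Sxy] := cover x y => //.
  apply: contra nxy; rewrite le_eqVlt => /orP[/eqP e|//].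
  by rewrite e lexx in nyx.
by case: (Lyx i); case: (HL i) => _; apply.
Qed.

End LinearExtension.

Lemma neq_negb (b b' : bool) : b' != b -> b' = ~~ b.
Proof. by case: b b' => -[]. Qed.

Section Tracks.
Variables (T : finType) (le : rel T) (pos : T -> nat).
Variable tr : nat -> bool -> option T.
Hypothesis le_tr : transitive le.

Definition up x i b := if tr i b is Some a then le x a else false.
Definition down y i b := if tr i b is Some a then le a y else false.

Hypothesis sep : forall x y i, le x y -> (pos x < i) != (pos y < i) ->
  exists b, up x i b && down y i b.
Hypothesis step : forall i, exists b, tr i.+1 b = tr i b.

Definition between x y i := (pos x < i <= pos y)%N.

(* The classes (true, _) contain the pairs for which the up-set of [x] or the
   down-set of [y] misses a separator between them; in (false, b), the up-set
   uses only the track [b] all the way and the down-set only the other one. *)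
Definition pair_class (k : bool * bool) (x y : T) : bool :=
  [&& ~~ le x y, pos x < pos y & `[<
    match k with
    | (true, true) => exists2 i, between x y i & forall b, ~~ up x i b
    | (true, false) => exists2 i, between x y i & forall b, ~~ down y i b
    | (false, b) => forall i, between x y i -> up x i b /\ down y i (~~ b)
    end >] ].

Let up_down x y i b : up x i b -> down y i b -> le x y.
Proof. by rewrite /up /down; case: (tr i b) => // a; apply: le_tr. Qed.

Lemma pair_class_cover x y : ~~ le x y -> pos x < pos y ->
  exists k, pair_class k x y.
Proof.
move=> nxy xy.
have [U|nU] := boolP (pair_class (true, true) x y); first by exists (true, true).
have [D|nD] := boolP (pair_class (true, false) x y); first by exists (true, false).
have exU i : between x y i -> exists b, up x i b.
  move=> bi; apply: contrapT => nex; case/negP: nU; rewrite /pair_class nxy xy /=.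
  by apply/asboolP; exists i => // b; apply/negP => ub; apply: nex; exists b.
have exD i : between x y i -> exists b, down y i b.
  move=> bi; apply: contrapT => nex; case/negP: nD; rewrite /pair_class nxy xy /=.
  by apply/asboolP; exists i => // b; apply/negP => ub; apply: nex; exists b.
have nUD i b : up x i b -> ~~ down y i b.
  by move=> ub; apply: contra nxy; apply: up_down.
have opp i b : between x y i -> up x i b -> down y i (~~ b).
  move=> bi ub; have [b' db] := exD i bi.
  by rewrite -(@neq_negb b b') //; apply: contraTneq db => ->; apply: nUD.
have opp' i b : between x y i -> down y i (~~ b) -> up x i b.
  move=> bi db; have [b' ub] := exU i bi.
  rewrite -[b]negbK -(@neq_negb (~~ b) b') //.
  by apply: contraTneq db => <-; apply: nUD.
have [b ub] : exists b, up x (pos x).+1 b by apply: exU; rewrite /between ltnSn.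
exists (false, b); rewrite /pair_class nxy xy; apply/asboolP => i.
suff bup : between x y i -> up x i b by move=> bi; split; [|apply: opp]; rewrite ?bup.
elim: i => [|i IHi] bi; first by move: bi; rewrite /between ltn0.
move: (bi); rewrite /between ltnS leq_eqVlt => /andP[/orP[/eqP<- //|xi] iy].
have bi' : between x y i by rewrite /between xi ltnW.
have ui := IHi bi'; have di := opp _ _ bi' ui.
have [b' eb'] := step i.
have [e|/neq_negb e] := eqVneq b' b; first by rewrite /up -e eb' e.
by apply: opp' => //; rewrite /down -e eb' e.
Qed.

Lemma pair_class_acyclic k : acyclic (fun p q : T * T =>
  [&& pair_class k p.1 p.2, pair_class k q.1 q.2 & le p.1 q.2]).
Proof.
have sepb x y i : le x y -> between x y i -> exists b, up x i b && down y i b.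
  move=> xy /andP[xi iy]; apply: sep => //.
  by rewrite xi ltnNge iy.
case: k => -[] b.
- case: b.
  + apply: (acyclic_criterion (m := fun p => pos p.2)) => p q.
    case/and3P=> /and3P[_ _ /asboolP[i /andP[xi iy] nu]] _ le_pq; left.
    rewrite (leq_trans _ iy) // ltnNge; apply/negP => iq.
    have [|b /andP[ub _]] := sepb _ _ i le_pq; first by rewrite /between xi.
    by rewrite (negbTE (nu b)) in ub.
  + apply: (acyclic_criterion (m := fun p => pos p.1)) => p q.
    case/and3P=> _ /and3P[_ _ /asboolP[i /andP[xi iy] nu]] le_pq; left.
    rewrite (leq_trans xi) // leqNgt; apply/negP => iq.
    have [|b /andP[_ ub]] := sepb _ _ i le_pq; first by rewrite /between iq.
    by rewrite (negbTE (nu b)) in ub.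
apply: (acyclic_criterion (m := fun p => pos p.2)) => p q.
have classP x y : pair_class (false, b) x y ->
  [/\ ~~ le x y, (pos x < pos y)%N &
      forall i, between x y i -> up x i b /\ down y i (~~ b)].
  by case/and3P=> ? ? /asboolP.
have onlyU x y i : pair_class (false, b) x y -> between x y i -> ~~ up x i (~~ b).
  case/classP=> nxy _ H bi; apply: contra nxy => /up_down; apply.
  by case: (H i bi).
have onlyD x y i : pair_class (false, b) x y -> between x y i -> ~~ down y i b.
  case/classP=> nxy _ H bi; apply: contra nxy; apply: up_down.
  by case: (H i bi).
case/and3P=> cp cq le_pq.
have [|yy] := ltnP (pos q.2) (pos p.2); [by left | right].
(* From here on [q] lies entirely to the right of [p], so [p.1 <= q.2] has to
   switch tracks; at the switching separator [c] both tracks lie between [p.1]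
   and [q.2], and no other pair of a chordless cycle can get across [c]. *)
have [_ xp Hp] := classP _ _ cp; have [_ xq Hq] := classP _ _ cq.
have disj : (pos p.2 <= pos q.1)%N.
  rewrite leqNgt; apply/negP => lt.
  have bp : between p.1 p.2 (pos p.2) by rewrite /between xp leqnn.
  have bq : between q.1 q.2 (pos p.2) by rewrite /between lt.
  have [|b' /andP[ub db]] := sepb _ _ (pos p.2) le_pq; first by rewrite /between xp.
  have [e|/neq_negb e] := eqVneq b' b.
    by move: (onlyD _ _ _ cq bq); rewrite -e db.
  by move: (onlyU _ _ _ cp bp); rewrite -e ub.
pose on i b' := up p.1 i b' && down q.2 i b'.
have [c /andP[pc cq1] /andP[con con']] :
  exists2 c, (pos p.2 < c <= pos q.1)%N & on c b && on c (~~ b).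
  have exon i : (pos p.1 < i <= pos q.2)%N -> ~~ on i (~~ b) -> on i b.
    move=> /(sepb _ _ _ le_pq)[b' ob] nob.
    have [e|/neq_negb e] := eqVneq b' b; first by rewrite -e.
    by rewrite /on -e ob in nob.
  have bp : between p.1 p.2 (pos p.2) by rewrite /between xp leqnn.
  have bq : between q.1 q.2 (pos q.1).+1 by rewrite /between ltnSn.
  have nq : ~~ on (pos q.1).+1 b by rewrite /on negb_and (onlyD _ _ _ cq bq) orbT.
  have oq : on (pos q.1).+1 (~~ b).
    by apply: contraNT nq; apply: exon; lia.
  have np : ~~ on (pos p.2) (~~ b) by rewrite /on negb_and (onlyU _ _ _ cp bp).
  pose C i := (pos p.2 <= i)%N && on i (~~ b).
  have Cq : C (pos q.1).+1 by rewrite /C oq andbT; lia.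
  case: (ex_minnP (ex_intro C _ Cq)) => -[|c] /andP[pc oc] cmin.
    by move: np oc; rewrite (_ : pos p.2 = 0) => [/negbTE->|]; lia.
  have pc' : (pos p.2 <= c)%N.
    by rewrite -ltnS ltn_neqAle pc andbT; apply: contraTneq oc => <-.
  have cq' := cmin _ Cq.
  have noc : ~~ on c (~~ b).
    by apply/negP => oc'; have := cmin c; rewrite /C pc' oc' ltnn => /(_ isT).
  have ocb : on c b by apply: exon => //; lia.
  have [b' eb'] := step c.
  have ocS : on c.+1 b.
    have [e|/neq_negb e] := eqVneq b' b.
      by move: ocb; rewrite /on /up /down -e eb'.
    by move: noc oc; rewrite /on /up /down -e eb' => /negbTE->.
  exists c.+1; last by rewrite ocS.
  have: c.+1 != (pos q.1).+1 by apply: contraNneq nq => <-.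
  by move: pc' cq'; lia.
have onc b' : on c b' by move: con con'; case: (b) (b') => -[].
exists (fun r : T * T => (c <= pos r.1)%N); split=> //.
  by rewrite -ltnNge (ltn_trans xp).
move=> u w /and3P[cu cw le_uw]; rewrite cu cq cp cw /= => nuq npw cxu.
have nU b' : ~~ up u.1 c b'.
  apply: contra nuq => uc; apply: up_down uc _.
  by case/andP: (onc b').
have nD b' : ~~ down w.2 c b'.
  apply: contra npw; apply: up_down.
  by case/andP: (onc b').
have cyw : (c <= pos w.2)%N.
  rewrite leqNgt; apply/negP => wc.
  have [|b' /andP[ub _]] := sep (i := c) le_uw; first by rewrite wc ltnNge cxu.
  by rewrite (negbTE (nU b')) in ub.
rewrite leqNgt; apply/negP => xwc.
have [_ _ Hw] := classP _ _ cw.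
by have [|_] := Hw c; rewrite /between ?xwc // (negbTE (nD _)).
Qed.

End Tracks.

Section Sweep.
Variables (T : finType) (E : rel T) (bags : seq {set T}).
Hypothesis bagsP : path_decomposition E bags.
Hypothesis bags_small : forall B, B \in bags -> #|B| <= 3.

Let bag := nth set0 bags.

Definition first_bag (v : T) : nat := find (fun B : {set T} => v \in B) bags.

Definition sweep (v : T) : nat := (first_bag v * #|T| + enum_rank v)%N.

(* All [w] with [k <= sweep w] give the same condition as the least of them, by
   convexity, so at most two elements other than that [w] are left. *)
Definition separator (k : nat) : {set T} :=
  [set u | (sweep u < k) && [exists w, (k <= sweep w) && (u \in bag (first_bag w))]].

(* Each separator is contained in the values of two tracks, only one of which
   changes per step.  A track value may be stale, i.e. outside the separator. *)
Fixpoint track (k : nat) : bool -> option T :=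
  if k isn't k'.+1 then fun=> None else
  if [pick v | (sweep v == k') && (v \in separator k)] is Some v then
    let keep b := if track k' b is Some t then (t != v) && (t \in separator k)
                  else false in
    if keep true then fun b => if b then track k' b else Some v
    else fun b => if b then Some v else track k' b
  else track k'.

Let first_in v : (first_bag v < size bags)%N /\ v \in bag (first_bag v).
Proof.
have hv : has (fun B : {set T} => v \in B) bags.
  by case: bagsP => /(_ v)[B Bb vB] _ _; apply/hasP; exists B.
by rewrite -has_find hv /bag (nth_find set0 hv).
Qed.

Let bag_convex v i j : v \in bag j -> (first_bag v <= i <= j)%N -> v \in bag i.
Proof.
move=> vj /andP[fi ij].
have szj : (j < size bags)%N.
  by rewrite ltnNge; apply/negP => le; rewrite /bag nth_default ?inE in vj.
have [_ vf] := first_in v.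
move: fi; rewrite leq_eqVlt => /orP[/eqP<- //|fi].
move: ij; rewrite leq_eqVlt => /orP[/eqP-> //|ij].
case: bagsP => _ _ /(_ (first_bag v) i j); rewrite fi ij => /(_ isT szj).
by move/subsetP; apply; rewrite inE vf.
Qed.

Let sweep_first u w : (sweep u <= sweep w)%N -> (first_bag u <= first_bag w)%N.
Proof.
apply: contraTT; rewrite -!ltnNge /sweep => lt.
have le : (first_bag w * #|T| + #|T| <= first_bag u * #|T|)%N.
  by rewrite addnC -mulSn leq_mul2r lt orbT.
by apply: leq_trans (leq_addr _ _); apply: leq_trans le; rewrite ltn_add2l.
Qed.

Lemma sweep_inj : injective sweep.
Proof.
move=> u w /(congr1 (modn^~ #|T|)); rewrite /sweep !modnMDl.
by rewrite !modn_small ?ltn_ord // => /val_inj/enum_rank_inj.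
Qed.

Let card_separator k : #|separator k| <= 2.
Proof.
have [->|[u0]] := set_0Vmem (separator k); first by rewrite cards0.
rewrite inE => /andP[_ /existsP[w0 /andP[kw0 _]]].
case: (@arg_minnP _ w0 (fun w => k <= sweep w) sweep kw0) => w kw wmin.
have [wsz ww] := first_in w.
rewrite -ltnS; apply: leq_trans (bags_small (mem_nth set0 wsz)).
apply: proper_card; apply/properP; split; last first.
  by exists w => //; rewrite inE ltnNge kw.
apply/subsetP => u; rewrite inE => /andP[uk /existsP[w' /andP[kw' uw']]].
apply: bag_convex uw' _; rewrite !sweep_first ?wmin //.
exact: ltnW (leq_trans uk kw).
Qed.

Lemma separator_edge u w k : E u w || E w u -> (sweep u < k <= sweep w)%N ->
  u \in separator k.
Proof.
move=> uw /andP[uk kw]; rewrite inE uk; apply/existsP; exists w; rewrite kw.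
have [B Bb /andP[uB wB]] : exists2 B, B \in bags & (u \in B) && (w \in B).
  case: bagsP => _ cov _; case/orP: uw => /cov[B Bb]; exists B => //.
  by rewrite andbC.
have eB : bag (index B bags) = B by rewrite /bag nth_index.
apply: (@bag_convex _ _ (index B bags)); first by rewrite eB.
rewrite sweep_first ?(ltnW (leq_trans uk kw)) //= leqNgt.
by apply/negP => /(before_find set0); rewrite nth_index // wB.
Qed.

Lemma track_step k : exists b, track k.+1 b = track k b.
Proof.
rewrite /=; case: pickP => [v _|_]; last by exists true.
by case: ifP => _; [exists true | exists false].
Qed.

Lemma separator_track k u : u \in separator k -> exists b, track k b = Some u.
Proof.
elim: k u => [|k IHk] u; first by rewrite inE ltn0.
move=> uS.
have uk : sweep u != k -> exists b, track k b = Some u.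
  move=> nk; apply: IHk; move: uS; rewrite !inE ltnS leq_eqVlt (negbTE nk) /=.
  case/andP=> -> /existsP[w /andP[kw uw]]; apply/existsP; exists w.
  by rewrite ltnW.
rewrite /=; case: pickP => [v /andP[/eqP vk vS]|nv]; last first.
  by apply: uk; apply/negP => /eqP e; move: (nv u); rewrite e eqxx uS.
have [e|nuv] := eqVneq u v.
  by rewrite e; case: ifP => _; [exists false | exists true].
have [|b eb] := uk; first by rewrite -vk (inj_eq sweep_inj).
case: b eb => eb.
  by rewrite eb nuv uS; exists true.
case et: (track k true) => [t|]; last by exists false.
case: ifP => [/andP[ntv tS]|_]; last by exists false.
exists true; rewrite et; congr Some; apply/eqP; apply: contraT => ntu.
have: 2 < #|separator k.+1| by apply/card_gt2P; exists t, u, v; rewrite ntu nuv eq_sym.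
by rewrite ltnNge card_separator.
Qed.

End Sweep.

Section PathwidthTwo.
Context {d : Order.disp_t} (P : finPOrderType d).
Local Open Scope order_scope.
Variable bags : seq {set P}.
Hypothesis bagsP : path_decomposition (cover_graph P) bags.
Hypothesis bags_small : forall B, B \in bags -> (#|B| <= 3)%N.

Let pos := sweep bags.
Let tr := track bags.

Lemma le_separator (x y : P) (k : nat) : x <= y -> (pos x < k)%N != (pos y < k)%N ->
  exists2 a, a \in separator bags k & x <= a <= y.
Proof.
have [n] := ubnP #|[set z | x <= z <= y]|; elim: n x y => // n IHn x y.
rewrite ltnS => sz xy sxy.
have nxy : x != y by apply: contraNneq sxy => ->.
have [cxy|] := boolP (covered_by x y).
  have [xk|xk] := ltnP (pos x) k.
    exists x; rewrite ?lexx //; apply: (separator_edge bagsP (w := y)).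
      by rewrite /cover_graph cxy.
    by move: sxy; rewrite xk -leqNgt.
  exists y; rewrite ?lexx ?xy //; apply: (separator_edge bagsP (w := x)).
    by rewrite /cover_graph cxy !orbT.
  by move: sxy; rewrite ltnNge xk /=; case: ltnP.
rewrite /covered_by lt_neqAle nxy xy /= negbK => /existsP[z /andP[xz zy]].
have IH (x' y' : P) : x <= x' -> x' <= y' -> y' <= y -> (x != x') || (y != y') ->
    (pos x' < k)%N != (pos y' < k)%N ->
    exists2 a, a \in separator bags k & x <= a <= y.
  move=> xx' xy' yy' ne sxy'.
  have [|||a aS /andP[xa ay]] := IHn x' y' => //.
    apply: leq_trans sz; apply: proper_card; apply/properP; split.
      apply/subsetP => z'; rewrite !inE => /andP[/(le_trans xx')-> zy'].
      exact: le_trans yy'.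
    case/orP: ne => ne; [exists x | exists y]; rewrite !inE ?lexx ?xy //.
      by apply: contra ne => /andP[x'x _]; apply/eqP/le_anti/andP.
    by apply: contra ne => /andP[_ yy'']; apply/eqP/le_anti/andP.
  by exists a; rewrite // (le_trans xx') // (le_trans ay).
have [szk|szk] := eqVneq (pos x < k)%N (pos z < k)%N.
  apply: (IH z y); rewrite ?lexx ?(ltW xz) ?(ltW zy) ?(lt_eqF xz) //.
  by rewrite -szk.
by apply: (IH x z); rewrite ?lexx ?(ltW xz) ?(ltW zy) ?(gt_eqF zy) ?orbT.
Qed.

Lemma le_track (x y : P) (k : nat) : x <= y -> (pos x < k)%N != (pos y < k)%N ->
  exists b, up <=%O tr x k b && down <=%O tr y k b.
Proof.
move=> xy /(le_separator xy)[a /(separator_track bagsP bags_small)[b eb] xay].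
by exists b; rewrite /up /down /tr eb.
Qed.

Lemma has_realizer_8 : has_realizer P 8.
Proof.
pose ge (x y : P) := y <= x.
have ge_tr : transitive ge by move=> y x z yx zy; exact: le_trans zy yx.
have sep_ge x y k : ge x y -> (pos x < k)%N != (pos y < k)%N ->
    exists b, up ge tr x k b && down ge tr y k b.
  move=> yx; rewrite eq_sym => /(le_track yx)[b /andP[ub db]].
  by exists b; apply/andP.
pose S (i : bool * (bool * bool)) (x y : P) :=
  if i.1 then pair_class <=%O pos tr i.2 x y else pair_class ge pos tr i.2 y x.
have <- : #|{: bool * (bool * bool)}| = 8 by rewrite !card_prod card_bool.
apply: (has_realizer_of_cover (true, (true, true)) (S := S)).
  case=> -[] k; rewrite /S.
    exact: (pair_class_acyclic le_trans le_track (track_step bags)).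
  have := pair_class_acyclic ge_tr sep_ge (track_step bags) (k := k).
  move/(acyclic_preim (f := fun p : P * P => (p.2, p.1)))/acyclic_rev.
  by apply: eq_acyclic => p q; rewrite /alternating /= andbCA.
move=> x y nxy nyx.
have [lt|lt|/sweep_inj e] := ltngtP (pos x) (pos y).
- have [k Sk] := pair_class_cover le_trans (track_step bags) nxy lt.
  by exists (true, k).
- have [k Sk] := pair_class_cover ge_tr (track_step bags) (nxy : ~~ ge y x) lt.
  by exists (false, k).
- by rewrite e lexx in nxy.
Qed.

End PathwidthTwo.

Theorem theorem1p3 (d : Order.disp_t) (P : finPOrderType d) :
  (pathwidth (cover_graph P) <= 2)%N -> (poset_dim P <= 17)%N.
Proof.
rewrite /pathwidth; case: ex_minnP => w /asboolP[bags bagsP <-] _ w2.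
have dim8 : has_realizer P 8.
  apply: has_realizer_8 bagsP _ => B Bb.
  pose F (C : {set P}) := #|C|.
  apply: leq_trans (leq_bigmax_seq (P := xpredT) (F := F) B Bb isT) _.
  by rewrite -(leq_subLR _ 1) subn1.
rewrite /poset_dim; case: ex_minnP => t _ /(_ 8) tmin.
by apply: (leq_trans (tmin _)) => //; apply/asboolP.
Qed.
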